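(* Let $P\in\mathcal{B}(\mathcal{H})$ be an idempotent. Then $$(2P-I)\,|2P-I|^{-1}=(P+P^{*}-I)\,|P+P^{*}-I|^{-1}.$$
   Context: $\mathcal{H}$ is a separable complex Hilbert space and $\mathcal{B}(\mathcal{H})$ is the set of bounded linear operators on $\mathcal{H}$. An idempotent is $P\in\mathcal{B}(\mathcal{H})$ with $P^2=P$ (not necessarily self-adjoint). $|A|:=(A^*A)^{1/2}$ is the absolute value of $A$. For an idempotent $P$, both $2P-I$ and $P+P^*-I$ are invertible (hence so are their absolute values). *)

(* Defs.v *)
From HB Require Import structures.
From mathcomp Require Import all_boot all_order all_algebra.
From mathcomp Require Import sesquilinear.
From mathcomp Require Import all_classical all_reals all_analysis.
From mathcomp Require Import complex.

Set Implicit Arguments.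
Unset Strict Implicit.
Unset Printing Implicit Defensive.

Import Order.TTheory GRing.Theory Num.Theory.
Import numFieldNormedType.Exports.

Local Open Scope classical_set_scope.
Local Open Scope complex_scope.
Local Open Scope ring_scope.

(* Complex Hilbert spaces. The inner product is linear in its first argument
   and conjugate-linear in its second one. The norm of a normed module over
   R[i] takes its values in the nonnegative reals of R[i]. *)
HB.mixin Record CompleteNormedModule_isHilbert (R : realType) (H : Type)
    & CompleteNormedModule R[i] H := {
  inner : {dot H for (@Num.conj R[i])} ;
  sqr_norm_inner : forall x : H, `|x| ^+ 2 = inner x x
}.

#[short(type="hilbertType")]
HB.structure Definition Hilbert (R : realType) :=
  {H of CompleteNormedModule R[i] H & CompleteNormedModule_isHilbert R H}.

Definition separable_space (T : topologicalType) :=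
  exists2 D : set T, countable D & dense D.

Section BoundedOperators.
Context (R : realType) (H : hilbertType R).
Implicit Types f g : H -> H.

Definition is_bounded_linear f :=
  linear f /\ exists M : R[i], forall x, `|f x| <= M * `|x|.

Definition bounded_linear : {pred H -> H} :=
  [pred f | `[< is_bounded_linear f >]].

Lemma bounded_linearP f : reflect (is_bounded_linear f) (f \in bounded_linear).
Proof. exact: asboolP. Qed.

Lemma bounded_linear_ge0 f : f \in bounded_linear ->
  exists2 M : R[i], 0 <= M & forall x, `|f x| <= M * `|x|.
Proof.
move=> /bounded_linearP[_ [M fM]]; exists `|M| => // x.
rewrite -[X in _ * X]normr_id -normrM ger0_norm ?fM//.
exact: le_trans (fM x).
Qed.

Lemma bounded_linear_submod_closed : submod_closed bounded_linear.
Proof.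
split.
  apply/bounded_linearP; split=> [a x y|]; first by rewrite scaler0 addr0.
  by exists 0 => x; rewrite mul0r normr0.
move=> a f g fB gB; have [M M0 fM] := bounded_linear_ge0 fB.
have [N N0 gN] := bounded_linear_ge0 gB.
move: fB gB => /bounded_linearP[lf _] /bounded_linearP[lg _].
apply/bounded_linearP; split=> [b x y|].
  rewrite !fctE lf lg !scalerDr !scalerA (mulrC a b) -!addrA; congr (_ + _).
  by rewrite addrCA.
exists (`|a| * M + N) => x; rewrite !fctE (le_trans (ler_normD _ _))// mulrDl.
by rewrite lerD// normrZ -mulrA ler_wpM2l.
Qed.

HB.instance Definition _ := GRing.isSubmodClosed.Build R[i] (H -> H)
  bounded_linear bounded_linear_submod_closed.

(* The algebra B(H): [val A] is the underlying map, sums and multiples are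
   pointwise. *)
Record bop := Bop { bop_val :> H -> H ; _ : bop_val \in bounded_linear }.

HB.instance Definition _ := [isSub for bop_val].
HB.instance Definition _ := [Choice of bop by <:].
HB.instance Definition _ := [SubChoice_isSubLmodule of bop by <:].

Implicit Types A B C S : bop.

Lemma bounded_linear_id : id \in bounded_linear.
Proof.
by apply/bounded_linearP; split=> //; exists 1 => x; rewrite mul1r.
Qed.

Lemma bounded_linear_comp f g :
  f \in bounded_linear -> g \in bounded_linear -> f \o g \in bounded_linear.
Proof.
move=> fB gB; have [M M0 fM] := bounded_linear_ge0 fB.
have [N N0 gN] := bounded_linear_ge0 gB.
move: fB gB => /bounded_linearP[lf _] /bounded_linearP[lg _].
apply/bounded_linearP; split=> [a x y|]; first by rewrite /= lg lf.
by exists (M * N) => x; rewrite (le_trans (fM _))// -mulrA ler_wpM2l.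
Qed.

Definition bop_one : bop := Bop bounded_linear_id.

Definition bop_mul A B : bop := Bop (bounded_linear_comp (valP A) (valP B)).

Lemma bop_linear A : linear A.
Proof. by have /bounded_linearP[] := valP A. Qed.

Lemma bop_mulA : associative bop_mul.
Proof. by move=> A B C; apply: val_inj. Qed.

Lemma bop_mul1r : left_id bop_one bop_mul.
Proof. by move=> A; apply: val_inj. Qed.

Lemma bop_mulr1 : right_id bop_one bop_mul.
Proof. by move=> A; apply: val_inj. Qed.

Lemma bop_mulDl : left_distributive bop_mul +%R.
Proof. by move=> A B C; apply: val_inj. Qed.

Lemma bop_mulDr : right_distributive bop_mul +%R.
Proof.
move=> A B C; apply: val_inj; apply/funext => x /=.
by have := bop_linear A 1 (B x) (C x); rewrite !scale1r.
Qed.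

(* The ring is possibly trivial, since H may be the zero space. *)
HB.instance Definition _ := GRing.Zmodule_isPzRing.Build bop
  bop_mulA bop_mul1r bop_mulr1 bop_mulDl bop_mulDr.

(* The adjoint exists and is unique by the Riesz representation theorem, so
   the default value 0 is never taken. *)
Definition adjoint A : bop :=
  xget 0 [set B : bop | forall x y : H, inner (A x) y = inner x (B y)].

(* In the order of R[i], [0 <= z] entails that z is real; on a complex Hilbert
   space this forces S to be self-adjoint. *)
Definition bop_positive S : Prop := forall x : H, 0 <= inner (S x) x.

(* A positive operator has exactly one positive square root; the default value
   0 is only taken when A is not positive. *)
Definition bop_sqrt A : bop := xget 0 [set S : bop | bop_positive S /\ S * S = A].

Definition bop_abs A : bop := bop_sqrt (adjoint A * A).

(* 0 when A is not invertible in B(H). *)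
Definition bop_inv A : bop := xget 0 [set B : bop | A * B = 1 /\ B * A = 1].

End BoundedOperators.

Arguments bop {R} H.

(* Main.v *)
Require Import Defs.
From mathcomp Require Import all_boot all_order all_algebra.
From mathcomp Require Import sesquilinear ring lra.
From mathcomp Require Import all_classical all_reals all_analysis.
From mathcomp Require Import complex.

(** Write [S = 2 P - 1], so [S * S = 1], and [S'] for the adjoint of [S], so
    that [P + P' - 1 = T] with [T = (S + S') / 2]. The whole identity is
    carried by [Q = |S|] and [V = Q^-1]. As [Q * Q = S' * S] and [S' * S] has
    inverse [S * S'], one gets [V * V = S * S'], hence
      [((Q + V) / 2) ^ 2 = (S' * S + 2 + S * S') / 4 = T * T = T' * T],
    and [(Q + V) / 2] is positive: by uniqueness of positive square roots it
    is [|T|]. Then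
      [S * V * |T| = (S * V * Q + S * V * V) / 2 = (S + S') / 2 = T],
    and cancelling the invertible [|T|] gives [S |S|^-1 = T |T|^-1]. This is
    [involution_phase].

    What remains is that adjoints, positive square roots and the inverses of
    [|S|] and [|T|] exist. Only the real Hilbert space underlying [H] matters
    for most of it, so the estimates are made with [rinner] and [rnorm], the
    real parts of the inner product and of the norm.
    - Adjoints come from the Riesz representation theorem: the representing
      vector minimizes [|x| ^ 2 - 2 f x], and the parallelogram law makes
      minimizing sequences Cauchy.
    - If [G] is bounded below then [G' * G = K (1 - B)] with [B] self-adjoint
      of norm less than 1. The root of [1 - B] is [1 - Y] where [Y] is a fixed
      point of the contraction [Y |-> (B + Y * Y) / 2] of a ball of B(H), and
      [1 - Y] is inverted by another fixed point (Neumann). That [Y] is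
      self-adjoint, and commutes with whatever commutes with [B], is seen by
      bounding a difference [D] by a fraction of itself ([op_contraction0]).
    - The root [Q] so built is coercive and commutes with any other positive
      root [U], as [U] commutes with [U * U]; then [(U + Q) * (U - Q) = 0]
      forces [U = Q]. *)

Set Implicit Arguments.
Unset Strict Implicit.
Unset Printing Implicit Defensive.

Import Order.TTheory GRing.Theory Num.Theory.
Import numFieldNormedType.Exports.

Local Open Scope classical_set_scope.
Local Open Scope complex_scope.
Local Open Scope ring_scope.

Local Notation Re := complex.Re.
Local Notation Im := complex.Im.

Section HilbertSpaceOperators.
Context (R : realType) (H : hilbertType R).
Implicit Types (x y z : H) (f g : H -> H).
Implicit Types (A B C D G P Q S T V : bop H) (b r M : R).

(** * The underlying real Hilbert space *)

Definition rinner x y : R := Re (inner x y).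
Definition rnorm x : R := Re `|x|.

Lemma rnormE x : `|x| = (rnorm x)%:C.
Proof. by rewrite /rnorm RRe_real// ger0_real. Qed.

Lemma rnorm_ge0 x : 0 <= rnorm x.
Proof. by rewrite -ler0c -rnormE. Qed.

Lemma rnorm0_eq0 x : rnorm x = 0 -> x = 0.
Proof. by move=> x0; apply/eqP; rewrite -normr_eq0 rnormE x0. Qed.

Lemma rnorm0 : rnorm 0 = 0.
Proof. by rewrite /rnorm normr0. Qed.

Lemma rnormN x : rnorm (- x) = rnorm x.
Proof. by rewrite /rnorm normrN. Qed.

Lemma rnorm_distC x y : rnorm (x - y) = rnorm (y - x).
Proof. by rewrite -rnormN opprB. Qed.

Lemma rnormD x y : rnorm (x + y) <= rnorm x + rnorm y.
Proof. by rewrite -lecR rmorphD/= -!rnormE ler_normD. Qed.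

Lemma rnormZ (t : R) x : rnorm (t%:C *: x) = `|t| * rnorm x.
Proof.
apply: complexI; rewrite rmorphM/= -!rnormE normrZ normc_def/=.
by rewrite [X in _ + X]expr0n addr0 sqrtr_sqr.
Qed.

Lemma innerC x y : inner x y = (inner y x)^*.
Proof. by have := hermC (@inner R H) x y; rewrite expr0 mul1r. Qed.

Lemma rinnerC x y : rinner x y = rinner y x.
Proof. by rewrite /rinner innerC; case: (inner y x). Qed.

Lemma rinnerDl x y z : rinner (x + y) z = rinner x z + rinner y z.
Proof. by rewrite /rinner linearDl raddfD. Qed.

Lemma rinnerDr x y z : rinner z (x + y) = rinner z x + rinner z y.
Proof. by rewrite rinnerC rinnerDl !(rinnerC z). Qed.

Lemma rinnerZl (t : R) x y : rinner (t%:C *: x) y = t * rinner x y.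
Proof.
rewrite /rinner linearZl_LR/=; case: (inner x y) => a b /=; ring.
Qed.

Lemma rinnerZr (t : R) x y : rinner x (t%:C *: y) = t * rinner x y.
Proof. by rewrite rinnerC rinnerZl rinnerC. Qed.

Lemma rinnerNl x y : rinner (- x) y = - rinner x y.
Proof. by rewrite /rinner linearNl raddfN. Qed.

Lemma rinnerNr x y : rinner x (- y) = - rinner x y.
Proof. by rewrite rinnerC rinnerNl rinnerC. Qed.

Lemma rinner0l x : rinner 0 x = 0.
Proof. by rewrite -[0 in LHS](subrr x) rinnerDl rinnerNl subrr. Qed.

Lemma rnorm_sqr x : rnorm x ^+ 2 = rinner x x.
Proof.
apply: complexI; rewrite rmorphXn/= -rnormE sqr_norm_inner /rinner RRe_real//.
by rewrite -sqr_norm_inner ger0_real ?exprn_ge0.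
Qed.

Definition rinnerE := (rinnerDl, rinnerDr, rinnerNl, rinnerNr, rinnerZl, rinnerZr).

(** Cauchy-Schwarz: expand the square norm of [|y| x - |x| y]. *)
Lemma rinner_le x y : rinner x y <= rnorm x * rnorm y.
Proof.
have nx := rnorm_ge0 x; have ny := rnorm_ge0 y.
have /(_ (rnorm y) (rnorm x)) : forall a b : R,
    0 <= a ^+ 2 * rnorm x ^+ 2 - 2 * a * b * rinner x y + b ^+ 2 * rnorm y ^+ 2.
  move=> a b; have := sqr_ge0 (rnorm (a%:C *: x - b%:C *: y)).
  by rewrite !rnorm_sqr !rinnerE (rinnerC y x); lra.
have [/rnorm0_eq0 ->|x0] := eqVneq (rnorm x) 0.
  by move=> _; rewrite rinner0l rnorm0 mul0r.
have [/rnorm0_eq0 ->|y0] := eqVneq (rnorm y) 0.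
  by move=> _; rewrite rinnerC rinner0l rnorm0 mulr0.
have {}nx : 0 < rnorm x by rewrite lt_def x0.
have {}ny : 0 < rnorm y by rewrite lt_def y0.
have xy := mulr_gt0 nx ny => h.
rewrite -(ler_pM2l xy); lra.
Qed.

Lemma rinner_ext x x' : (forall y, rinner x y = rinner x' y) -> x = x'.
Proof.
move=> xx'; apply/eqP; rewrite -subr_eq0; apply/eqP/rnorm0_eq0/eqP.
by rewrite -sqrf_eq0 rnorm_sqr rinnerDl rinnerNl xx' subrr.
Qed.

(** The real inner product determines the complex one. *)
Lemma Im_inner_rinner x y : Im (inner x y) = rinner x ('i *: y).
Proof.
rewrite rinnerC /rinner linearZl_LR/= innerC; case: (inner y x) => a b /=; ring.
Qed.

(** Complex identities between inner products may therefore be checked on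
    real parts, at the price of one extra instance. *)
Lemma eq_inner_rinner x x' y y' :
  rinner x y = rinner x' y' -> rinner x ('i *: y) = rinner x' ('i *: y') ->
  inner x y = inner x' y'.
Proof.
rewrite -!Im_inner_rinner /rinner; case: (inner x y) (inner x' y') => a b [c d] /=.
by move=> -> ->.
Qed.

(** * Completeness *)

Lemma le_null_seq (a b C : R) (e : nat -> R) : e @ \oo --> (0 : R) ->
  (forall n, a <= b + C * e n) -> a <= b.
Proof.
move=> e0 ab; have : (b + C * e n) @[n --> \oo] --> b + C * 0.
  by apply: cvgD; [exact: cvg_cst | apply: cvgM => //; exact: cvg_cst].
rewrite mulr0 addr0 => be; rewrite -(cvg_lim _ be)//; apply: limr_ge.
  exact: cvgP be.
exact: nearW.
Qed.

(** The norm of [H] takes its values in [R[i]], and so do the radii of its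
    balls; this form of completeness has real error bounds only. *)
Lemma hilbert_cauchy (u : nat -> H) (e : nat -> R) : e @ \oo --> (0 : R) ->
  (forall n m, (n <= m)%N -> rnorm (u n - u m) <= e n) ->
  exists l, forall n, rnorm (u n - l) <= e n.
Proof.
move=> e0 ue.
have near_e (d : R[i]) : 0 < d -> exists N, (e N)%:C < d.
  move=> d0; have dR : d = (Re d)%:C by rewrite RRe_real// gtr0_real.
  have d0' : 0 < Re d by rewrite -ltcR -dR.
  have [N _ /(_ N (leqnn _))/= eN] : \forall n \near \oo, `|0 - e n| < Re d.
    exact: cvgr_dist_lt.
  exists N; rewrite dR ltcR (le_lt_trans (ler_norm _))//.
  by rewrite -normrN -sub0r.
have : cvg (u @ \oo).
  apply/cauchy_cvgP/cauchy_exP => d d0.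
  have [N eN] := near_e _ d0; exists (u N); exists N => // m /= Nm.
  rewrite -ball_normE/= rnormE (le_lt_trans _ eN)// lecR.
  exact: ue.
move=> /cvg_ex[/= l ul]; exists l => n.
rewrite -lecR -rnormE; apply/ler_addgt0Pr => d d0.
have [N _ uN] : \forall m \near \oo, `|l - u m| < d by exact: cvgr_dist_lt.
have := uN (maxn N n) (leq_maxl _ _) => /= /ltW h.
rewrite -(subrK (u (maxn N n)) (u n)) -addrA (le_trans (ler_normD _ _))//.
rewrite lerD//; last by rewrite distrC.
by rewrite rnormE lecR ue// leq_maxr.
Qed.

(** * Riesz representation and adjoints *)

Lemma rnorm_sqrD x y :
  rnorm (x + y) ^+ 2 = rnorm x ^+ 2 + 2 * rinner x y + rnorm y ^+ 2.
Proof. by rewrite !rnorm_sqr !rinnerE (rinnerC y x); ring. Qed.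

(** The functional is only real-linear, and represented in the real inner
    product. The vector minimizes [J x = |x| ^ 2 - 2 f x]: by the
    parallelogram law [|x - y| ^ 2 <= 2 (J x - m) + 2 (J y - m)] where [m] is
    the infimum of [J], so minimizing sequences converge. *)
Lemma riesz_representation (f : H -> R) (M : R) :
  (forall x y, f (x + y) = f x + f y) ->
  (forall (t : R) x, f (t%:C *: x) = t * f x) ->
  (forall x, `|f x| <= M * rnorm x) ->
  exists z, forall x, f x = rinner x z.
Proof.
move=> fD fZ fM; pose J x := rnorm x ^+ 2 - 2 * f x.
pose m := inf (range J).
have J_lb : has_lbound (range J).
  exists (- M ^+ 2) => _ [x _ <-]; rewrite /J.
  by have := fM x; have := ler_norm (f x); have := sqr_ge0 (rnorm x - M); lra.
have J_ge x : m <= J x by apply: ge_inf => //; exists x.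
have e_gt0 n : 0 < harmonic n :> R by exact: harmonic_gt0.
have e_ge0 n : 0 <= harmonic n :> R by exact/ltW.
(* The slack is such that the distances below are at most [harmonic n]. *)
have near_min n : exists x, J x < m + harmonic n ^+ 2 / 4.
  have [||_ [x _ <-] xm] := @inf_adherent R (range J) (harmonic n ^+ 2 / 4).
  - by rewrite divr_gt0// exprn_gt0.
  - by split=> //; exists (J 0); exists 0.
  - by exists x.
have [u uP] := choice near_min.
have [||l ul] := @hilbert_cauchy u (@harmonic R); first exact: cvg_harmonic.
  move=> n k nk; rewrite -(@ler_pXn2r _ 2)// ?nnegrE ?rnorm_ge0 ?e_ge0//.
  have := J_ge ((2^-1)%:C *: (u n + u k)); have := uP n; have := uP k.
  have : harmonic k ^+ 2 <= harmonic n ^+ 2 :> R.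
    rewrite ler_pXn2r// ?nnegrE ?e_ge0//.
    by rewrite /harmonic /= lef_pV2 ?posrE// ler_nat ltnS.
  rewrite /J rnormZ fZ fD exprMn real_normK ?num_real// !rnorm_sqrD rnormN rinnerNr.
  lra.
exists l => y; rewrite rinnerC; apply/eqP; rewrite -subr_eq0 -normr_le0.
apply: (@le_null_seq _ _ (rnorm y ^+ 2 / 2 + 1 / 8 + rnorm y) (@harmonic R)).
  exact: cvg_harmonic.
move=> n; rewrite add0r.
(* The derivative of [J] at [u n] along [y] is tested by steps of length
   [harmonic n], the order of the square root of the slack. *)
have := J_ge (u n + (harmonic n)%:C *: y).
have := J_ge (u n + (- harmonic n)%:C *: y).
have := uP n.
rewrite /J !rnorm_sqrD !fD !fZ !rnormZ !rinnerZr normrN gtr0_norm// => h0 h1 h2.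
have := rinner_le (u n - l) y; have := rinner_le (l - u n) y.
rewrite !rinnerDl !rinnerNl (rnorm_distC l) => h3 h4.
have h5 := ler_wpM2r (rnorm_ge0 y) (ul n).
set e := harmonic n in h0 h1 h2 h3 h4 h5 |- *.
have e0 : 0 < e by exact: e_gt0.
have h6 := ler_wpM2l (ltW e0) (le_trans h3 h5).
have h7 := ler_wpM2l (ltW e0) (le_trans h4 h5).
by rewrite ler_norml; apply/andP; split; rewrite -(ler_pM2l e0); lra.
Qed.

Lemma rinnerZr_conj (c : R[i]) x y : rinner x (c *: y) = rinner (c^* *: x) y.
Proof.
rewrite rinnerC /rinner !linearZl_LR/= (innerC y x).
by case: (inner x y) c => a b [d e] /=; ring.
Qed.

Lemma bopD (A : bop H) x y : A (x + y) = A x + A y.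
Proof. by have := bop_linear A 1 x y; rewrite !scale1r. Qed.

Lemma bop0 (A : bop H) : A 0 = 0.
Proof. by apply: (addrI (A 0)); rewrite -bopD !addr0. Qed.

Lemma bopZ (A : bop H) c x : A (c *: x) = c *: A x.
Proof. by have := bop_linear A c x 0; rewrite bop0 !addr0. Qed.

(** An upper bound for the operator norm, which itself is never formed. *)
Definition op_bound (f : H -> H) (M : R) := forall x, rnorm (f x) <= M * rnorm x.

Lemma op_boundP (A : bop H) : exists2 M, 0 <= M & op_bound A M.
Proof.
have [M M0 AM] := bounded_linear_ge0 (valP A).
have ME : M = (Re M)%:C by rewrite RRe_real// ger0_real.
exists (Re M); first by rewrite -ler0c -ME.
by move=> x; rewrite -lecR rmorphM/= -ME -!rnormE; exact: AM.
Qed.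

Lemma bop_of_bounded (f : H -> H) (M : R) :
  linear f -> op_bound f M ->
  exists A : bop H, forall x, A x = f x.
Proof.
move=> lf fM; have fB : f \in @bounded_linear R H.
  by apply/bounded_linearP; split=> //; exists M%:C => x; rewrite !rnormE -rmorphM lecR.
by exists (Bop fB).
Qed.

(** Stated for bare maps, since the bound on an adjoint is what makes it an
    element of B(H); for operators it amounts to the complex adjunction, by
    [is_adjoint_inner]. *)
Definition is_adjoint (f g : H -> H) :=
  forall x y, rinner (f x) y = rinner x (g y).

Lemma is_adjoint_inner (A B : bop H) :
  is_adjoint A B -> forall x y, inner (A x) y = inner x (B y).
Proof.
by move=> AB x y; apply: eq_inner_rinner; [|rewrite -(bopZ B)]; exact: AB.
Qed.

Lemma is_adjointC f g : is_adjoint f g -> is_adjoint g f.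
Proof. by move=> fg x y; rewrite rinnerC -fg rinnerC. Qed.

(** [|g x| ^ 2 = <f (g x), x> <= M |g x| |x|]. *)
Lemma is_adjoint_bound f g M :
  0 <= M -> is_adjoint f g -> op_bound f M -> op_bound g M.
Proof.
move=> M0 fg fM x; have [->|gx0] := eqVneq (rnorm (g x)) 0.
  by rewrite mulr_ge0 ?rnorm_ge0.
have {}gx0 : 0 < rnorm (g x) by rewrite lt_def gx0 rnorm_ge0.
rewrite -(ler_pM2l gx0) -expr2 rnorm_sqr -fg (le_trans (rinner_le _ _))//.
by rewrite mulrCA mulrA ler_wpM2r ?rnorm_ge0.
Qed.

Lemma adjoint_exists (A : bop H) : exists B : bop H, is_adjoint A B.
Proof.
have [M M0 AM] := op_boundP A.
have /choice[g gP] y : exists z, forall x, rinner (A x) y = rinner x z.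
  apply: (@riesz_representation _ (M * rnorm y)) => [x x'|t x|x].
  - by rewrite bopD rinnerDl.
  - by rewrite bopZ rinnerZl.
  - have h := ler_wpM2r (rnorm_ge0 y) (AM x).
    have := rinner_le (A x) y; have := rinner_le (- A x) y.
    by rewrite rnormN rinnerNl ler_norml => h1 h2; apply/andP; split; lra.
have lg : linear g.
  move=> c y y'; apply: rinner_ext => x; rewrite rinnerC -gP rinnerDr rinnerZr_conj.
  by rewrite -bopZ !gP -rinnerZr_conj -rinnerDr rinnerC.
have gM : op_bound g M by apply: (is_adjoint_bound M0 _ AM) => x y; exact: gP.
have [B BE] := bop_of_bounded lg gM; exists B => x y; by rewrite BE gP.
Qed.

(** * The algebra of bounded operators *)

Lemma bop_addE A B x : (A + B) x = A x + B x. Proof. by []. Qed.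
Lemma bop_oppE A x : (- A) x = - A x. Proof. by []. Qed.
Lemma bop_scaleE (c : R[i]) A x : (c *: A) x = c *: A x. Proof. by []. Qed.
Lemma bop_mulE A B x : (A * B) x = A (B x). Proof. by []. Qed.
Lemma bop_oneE x : (1 : bop H) x = x. Proof. by []. Qed.
Lemma bop_zeroE x : (0 : bop H) x = 0. Proof. by []. Qed.

Lemma bop_ext A B : A =1 B -> A = B.
Proof. by move=> AB; apply: val_inj; apply/funext. Qed.

Lemma bop_scaleAl (c : R[i]) A B : (c *: A) * B = c *: (A * B).
Proof. exact: bop_ext. Qed.

Lemma bop_scaleAr (c : R[i]) A B : A * (c *: B) = c *: (A * B).
Proof. by apply: bop_ext => x; exact: bopZ. Qed.

Lemma is_adjoint_uniq A B C : is_adjoint A B -> is_adjoint A C -> B = C.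
Proof.
move=> AB AC; apply: bop_ext => y; apply: rinner_ext => x.
by rewrite !(rinnerC _ x) -AB.
Qed.

Lemma adjointP A : is_adjoint A (adjoint A).
Proof.
have /xgetPex h : exists B, forall x y, inner (A x) y = inner x (B y).
  by have [B /is_adjoint_inner AB] := adjoint_exists A; exists B.
by move=> x y; rewrite /rinner -(h 0).
Qed.

Lemma adjointE A B : is_adjoint A B -> adjoint A = B.
Proof. exact/is_adjoint_uniq/adjointP. Qed.

Lemma op_bound_le M N A : M <= N -> op_bound A M -> op_bound A N.
Proof. by move=> MN AM x; rewrite (le_trans (AM x))// ler_wpM2r ?rnorm_ge0. Qed.

Lemma op_bound0 M : 0 <= M -> op_bound (0 : bop H) M.
Proof. by move=> M0 x; rewrite bop_zeroE rnorm0 mulr_ge0 ?rnorm_ge0. Qed.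

Lemma op_bound1 : op_bound (1 : bop H) 1.
Proof. by move=> x; rewrite mul1r. Qed.

Lemma op_boundD M N A B : op_bound A M -> op_bound B N ->
  op_bound (A + B) (M + N).
Proof.
move=> AM BN x; rewrite mulrDl (le_trans (rnormD _ _))//.
by apply: lerD; [exact: AM|exact: BN].
Qed.

Lemma op_boundN M A : op_bound A M -> op_bound (- A) M.
Proof. by move=> AM x; rewrite rnormN; exact: AM. Qed.

Lemma op_boundB M N A B : op_bound A M -> op_bound B N ->
  op_bound (A - B) (M + N).
Proof. by move=> AM /op_boundN; apply: op_boundD. Qed.

Lemma op_boundM M N A B : 0 <= M ->
  op_bound A M -> op_bound B N -> op_bound (A * B) (M * N).
Proof.
move=> M0 AM BN x; rewrite (le_trans (AM _))// -mulrA.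
by apply: ler_wpM2l => //; exact: BN.
Qed.

Lemma op_boundZ (t : R) M A : 0 <= t -> op_bound A M ->
  op_bound (t%:C *: A) (t * M).
Proof.
move=> t0 AM x; rewrite bop_scaleE rnormZ ger0_norm// -mulrA.
by apply: ler_wpM2l => //; exact: AM.
Qed.

Lemma op_bound_to0 A M (e : nat -> R) : e @ \oo --> (0 : R) ->
  (forall n, op_bound A (M * e n)) -> A = 0.
Proof.
move=> e0 AM; apply: bop_ext => x; apply/rnorm0_eq0/le_anti.
rewrite rnorm_ge0 andbT; apply: (le_null_seq (C := M * rnorm x) e0) => n.
by rewrite add0r mulrAC; exact: AM.
Qed.

Lemma cvg_expr0 b : 0 <= b -> b < 1 -> (fun n => b ^+ n) @ \oo --> (0 : R).
Proof. by move=> b0 b1; apply: cvg_expr; rewrite ger0_norm. Qed.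

(** The replacement for limit arguments: two operators are equal, or commute,
    as soon as their difference, or commutator, is dominated by a fraction of
    itself. *)
Lemma op_contraction0 b D : 0 <= b -> b < 1 ->
  (forall M, 0 <= M -> op_bound D M -> op_bound D (b * M)) -> D = 0.
Proof.
move=> b0 b1 Db; have [M M0 DM] := op_boundP D.
apply: (@op_bound_to0 _ M _ (cvg_expr0 b0 b1)); elim=> [|n IH].
  by rewrite expr0 mulr1.
by rewrite exprS mulrCA; apply: Db; rewrite // mulr_ge0// exprn_ge0.
Qed.

(** * Fixed points, inverses and square roots *)

(** B(H) is complete: the pointwise limit inherits linearity and a bound. *)
Lemma op_cauchy (U : nat -> bop H) (e : nat -> R) : e @ \oo --> (0 : R) ->
  (forall n m, (n <= m)%N -> op_bound (U n - U m) (e n)) ->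
  exists L : bop H, forall n, op_bound (U n - L) (e n).
Proof.
move=> e0 Ue.
have /choice[g gP] x : exists l, forall n, rnorm (U n x - l) <= e n * rnorm x.
  apply: hilbert_cauchy => [|n m nm]; last exact: Ue.
  by rewrite -(mul0r (rnorm x)); apply: cvgM => //; exact: cvg_cst.
have lg : linear g.
  move=> c x y; apply/eqP; rewrite -subr_eq0; apply/eqP/rnorm0_eq0/le_anti.
  rewrite rnorm_ge0 andbT.
  pose K := rnorm (c *: x + y) + Re `|c| * rnorm x + rnorm y.
  apply: (le_null_seq (C := K) e0) => n; rewrite {}/K.
  have -> : g (c *: x + y) - (c *: g x + g y) =
      (c *: (U n x - g x)) + (U n y - g y) - (U n (c *: x + y) - g (c *: x + y)).
    by rewrite bopD bopZ scalerBr addrACA -opprD opprB [RHS]addrC addrA subrK.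
  have cn z : rnorm (c *: z) = Re `|c| * rnorm z.
    by rewrite {1}/rnorm normrZ rnormE -{1}(RRe_real (normr_real c)) -rmorphM.
  rewrite add0r (le_trans (rnormD _ _))// rnormN.
  rewrite (le_trans (lerD (rnormD _ _) (lexx _)))// cn.
  have c0 : 0 <= Re `|c| by rewrite -ler0c RRe_real ?normr_real.
  have := ler_wpM2l c0 (gP x n); have := gP y n.
  have := gP (c *: x + y) n; lra.
have [M M0 UM] := op_boundP (U 0).
have gM : op_bound g (M + e 0).
  move=> x; rewrite -(subKr (U 0 x) (g x)) mulrDl (le_trans (rnormD _ _))//.
  by rewrite rnormN lerD.
have [L LE] := bop_of_bounded lg gM; exists L => n x.
by rewrite bop_addE bop_oppE LE; exact: gP.
Qed.

(** Banach's theorem on the ball of radius [r] of B(H): two orbits issued from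
    the ball stay within [2 r b ^ n] of each other, and comparing the orbit of
    0 with its own shifts shows that it is Cauchy. *)
Lemma op_fixed_point (F : bop H -> bop H) r b : 0 <= r -> 0 <= b -> b < 1 ->
  (forall A, op_bound A r -> op_bound (F A) r) ->
  (forall A B M, 0 <= M -> op_bound A r -> op_bound B r ->
     op_bound (A - B) M -> op_bound (F A - F B) (b * M)) ->
  exists2 Y : bop H, op_bound Y r & F Y = Y.
Proof.
move=> r0 b0 b1 Fr Fb.
have iter_ball n A : op_bound A r -> op_bound (iter n F A) r.
  by move=> Ar; elim: n => //= n IH; exact: Fr.
have iter_contract n A B : op_bound A r -> op_bound B r ->
    op_bound (iter n F A - iter n F B) ((r + r) * b ^+ n).
  move=> Ar Br; elim: n => [|n IH]; first by rewrite expr0 mulr1; exact: op_boundB.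
  rewrite exprS mulrCA /=; apply: Fb; rewrite ?mulr_ge0 ?addr_ge0 ?exprn_ge0//.
  - exact: iter_ball.
  - exact: iter_ball.
have zr : op_bound (0 : bop H) r by exact: op_bound0.
have e0 : (fun n => (r + r) * b ^+ n) @ \oo --> (0 : R).
  by rewrite -(mulr0 (r + r)); apply: cvgM; [exact: cvg_cst | exact: cvg_expr0].
have [|Y UY] := @op_cauchy (fun n => iter n F 0) _ e0.
  move=> n m /subnKC <-; rewrite iterD; apply: iter_contract => //.
  exact: iter_ball.
have Yr : op_bound Y r.
  move=> x; apply: (le_null_seq (C := rnorm x) e0) => n.
  rewrite -(subKr (iter n F 0 x) (Y x)) (le_trans (rnormD _ _))//.
  rewrite rnormN lerD//; first exact: iter_ball.
  by rewrite mulrC; exact: UY.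
exists Y => //; apply/eqP; rewrite -subr_eq0; apply/eqP.
apply: (@op_bound_to0 _ 2 _ e0) => n.
have -> : F Y - Y = (iter n.+1 F 0 - Y) - (F (iter n F 0) - F Y).
  by rewrite opprB [RHS]addrC addrA subrK.
have d_ge0 : 0 <= (r + r) * b ^+ n by rewrite mulr_ge0 ?addr_ge0 ?exprn_ge0.
rewrite mulrDl mul1r.
apply: op_boundB.
  apply: op_bound_le (UY n.+1); rewrite exprS mulrCA ler_piMl// ltW//.
apply: op_bound_le (Fb _ _ _ d_ge0 (iter_ball n _ zr) Yr (UY n)).
by rewrite ler_piMl// ltW.
Qed.

Definition is_inverse A V := A * V = 1 /\ V * A = 1.

(** A fixed point of [Z |-> 1 + B * Z] is a right inverse of [1 - B]. It is
    also a left inverse because the commutator of [B] and [Z] equals [B] times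
    itself, hence vanishes. *)
Lemma neumann b B : 0 <= b -> b < 1 -> op_bound B b ->
  exists V, is_inverse (1 - B) V.
Proof.
move=> b0 b1 Bb; have b1' : 0 < 1 - b by rewrite subr_gt0.
have r0 : 0 <= (1 - b)^-1 by rewrite invr_ge0 ltW.
have [||Z _ ZE] := @op_fixed_point (fun Z => 1 + B * Z) _ _ r0 b0 b1.
- move=> A Ar; have := op_boundD op_bound1 (op_boundM b0 Bb Ar).
  by apply: op_bound_le; rewrite le_eqVlt; apply/orP; left; apply/eqP; field; lra.
- move=> A C M M0 _ _ ACM; have -> : 1 + B * A - (1 + B * C) = B * (A - C).
    by rewrite mulrBr opprD addrACA subrr add0r.
  exact: op_boundM.
have BZ : B * Z - Z * B = 0.
  apply: (op_contraction0 b0 b1) => M M0 DM.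
  have -> : B * Z - Z * B = B * (B * Z - Z * B).
    rewrite -{1 2}ZE mulrDr mulrDl mulr1 mul1r opprD addrACA subrr add0r.
    by rewrite [RHS]mulrBr !mulrA.
  exact: op_boundM.
exists Z; split; first by rewrite mulrBl mul1r -{1}ZE addrK.
by rewrite mulrBr mulr1 -{1}ZE (subr0_eq BZ) addrK.
Qed.

Local Notation half := ((2^-1)%:C : R[i]).

Lemma half_double A : half *: (A + A) = A.
Proof.
rewrite -mulr2n -(scaler_nat 2 A) scalerA.
have -> : half * 2 = 1; last by rewrite scale1r.
rewrite -[2]/(2%:R) -[X in _ * X](rmorph_nat (real_complex R)) -rmorphM.
by rewrite mulVf ?pnatr_eq0.
Qed.

Lemma op_bound_double A M : op_bound (A + A) (M + M) -> op_bound A M.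
Proof.
have h0 : (0 : R) <= 2^-1 by [].
move=> /(op_boundZ h0); rewrite half_double; apply: op_bound_le; lra.
Qed.

(** [(1 - Y) ^ 2 = 1 - B] means [Y = (B + Y ^ 2) / 2], whose right-hand side is
    a contraction of the ball of radius [b]. With [Z] the adjoint of [Y], the
    difference [D = Y - Z] satisfies [2 D = Y D + D Z], and a commutator
    [D = C Y - Y C] with [C] commuting with [B] satisfies [2 D = D Y + Y D];
    both vanish since [b < 1]. *)
Lemma sqrt_of_one_sub b B : 0 <= b -> b < 1 -> op_bound B b -> is_adjoint B B ->
  exists Y : bop H, [/\ op_bound Y b, (1 - Y) * (1 - Y) = 1 - B, is_adjoint Y Y &
    forall C, C * B = B * C -> C * Y = Y * C].
Proof.
move=> b0 b1 Bb BB.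
have h0 : (0 : R) <= 2^-1 by [].
have sqB A C : A * A - C * C = A * (A - C) + (A - C) * C.
  by rewrite mulrBr mulrBl addrA subrK.
have [||Y Yb YE] := @op_fixed_point (fun Y => half *: (B + Y * Y)) _ _ b0 b0 b1.
- move=> A Ab; have := op_boundZ h0 (op_boundD Bb (op_boundM b0 Ab Ab)).
  apply: op_bound_le; nra.
- move=> A C M M0 Ab Cb ACM.
  have -> : half *: (B + A * A) - half *: (B + C * C) =
      half *: (A * (A - C) + (A - C) * C).
    by rewrite -scalerBr -sqB opprD addrACA subrr add0r.
  have := op_boundZ h0 (op_boundD (op_boundM b0 Ab ACM) (op_boundM M0 ACM Cb)).
  by apply: op_bound_le; lra.
have {}YE : Y + Y = B + Y * Y by rewrite -{1 2}YE -scalerDr half_double.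
exists Y; split=> //.
- rewrite mulrBr mulr1 mulrBl mul1r opprB addrACA -opprD YE opprD.
  by rewrite addrACA subrr addr0.
- have [Z YZ] := adjoint_exists Y.
  suff : Y - Z = 0 by move=> /subr0_eq {2}->.
  have Zb := is_adjoint_bound b0 YZ Yb.
  have ZE : Z + Z = B + Z * Z.
    apply: (@is_adjoint_uniq (Y + Y)) => x y.
      by rewrite !bop_addE !rinnerE !YZ.
    by rewrite YE !bop_addE !bop_mulE !rinnerE !YZ BB.
  apply: (op_contraction0 b0 b1) => M M0 DM.
  apply: op_bound_double.
  have -> : Y - Z + (Y - Z) = Y * (Y - Z) + (Y - Z) * Z.
    by rewrite -sqB addrACA -opprD YE ZE opprD addrACA subrr add0r.
  by rewrite [X in op_bound _ (_ + X)]mulrC; apply: op_boundD; apply: op_boundM.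
- move=> C CB; apply: subr0_eq; apply: (op_contraction0 b0 b1) => M M0 DM.
  apply: op_bound_double.
  have -> : C * Y - Y * C + (C * Y - Y * C) =
      (C * Y - Y * C) * Y + Y * (C * Y - Y * C).
    rewrite addrACA -opprD -mulrDr -mulrDl YE mulrDr mulrDl CB opprD addrACA.
    rewrite subrr add0r.
    by rewrite mulrBl mulrBr !mulrA addrA subrK.
  by rewrite [X in op_bound _ (X + _)]mulrC; apply: op_boundD; apply: op_boundM.
Qed.

(** * Absolute values *)

Lemma is_adjoint1 : is_adjoint (1 : bop H) (1 : bop H).
Proof. by []. Qed.

Lemma is_adjointD A A' B B' :
  is_adjoint A A' -> is_adjoint B B' -> is_adjoint (A + B) (A' + B').
Proof. by move=> AA BB x y; rewrite !bop_addE !rinnerE AA BB. Qed.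

Lemma is_adjointN A A' : is_adjoint A A' -> is_adjoint (- A) (- A').
Proof. by move=> AA x y; rewrite !bop_oppE !rinnerE AA. Qed.

Lemma is_adjointZ (t : R) A A' :
  is_adjoint A A' -> is_adjoint (t%:C *: A) (t%:C *: A').
Proof. by move=> AA x y; rewrite !bop_scaleE !rinnerE AA. Qed.

Lemma is_adjointM A A' B B' :
  is_adjoint A A' -> is_adjoint B B' -> is_adjoint (A * B) (B' * A').
Proof. by move=> AA BB x y; rewrite !bop_mulE AA BB. Qed.

(** Self-adjointness is what makes the complex number [<A x, x>] real. *)
Lemma bop_positiveP A :
  is_adjoint A A -> (forall x, 0 <= rinner (A x) x) -> bop_positive A.
Proof.
move=> AA A0 x; have := A0 x; rewrite lecE /rinner => -> /=; rewrite andbT.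
have := innerC (A x) x; rewrite (is_adjoint_inner AA).
case: (inner x (A x)) => a d [/eqP] /=; rewrite -addr_eq0 -mulr2n mulrn_eq0 /=.
by [].
Qed.

Lemma bop_positive_ge0 A x : bop_positive A -> 0 <= rinner (A x) x.
Proof. by move=> /(_ x); rewrite lecE => /andP[]. Qed.

Definition bounded_below (f : H -> H) (c : R) :=
  0 < c /\ forall x, c * rnorm x <= rnorm (f x).

(** With [|G x| <= M |x|] and [K = M ^ 2], the operator [B = 1 - G' G / K] has
    norm less than 1:
      [|B x| ^ 2 = |x| ^ 2 - 2 |G x| ^ 2 / K + |G' G x| ^ 2 / K ^ 2
                <= |x| ^ 2 - |G x| ^ 2 / K <= (1 - c ^ 2 / K) |x| ^ 2].
    The root is then [M (1 - Y)] with [(1 - Y) ^ 2 = 1 - B]. *)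
Lemma sqrt_exists G c : bounded_below G c ->
  exists Q : bop H, [/\ is_adjoint Q Q, Q * Q = adjoint G * G,
    exists2 d, 0 < d & forall x, d * rnorm x ^+ 2 <= rinner (Q x) x,
    exists V, is_inverse Q V &
    forall C, C * (adjoint G * G) = adjoint G * G * C -> C * Q = Q * C].
Proof.
move=> [c0 Gc]; have [N N0 GN] := op_boundP G.
(* Adding [c] ensures [0 < M] and [c ^+ 2 <= M ^+ 2]. *)
pose M := N + c; have M0 : 0 < M by rewrite ltr_wpDl.
have GM : op_bound G M by apply: op_bound_le GN; rewrite lerDl ltW.
have GG := @adjointP G; set A := adjoint G * G.
have AA : is_adjoint A A := is_adjointM (is_adjointC GG) GG.
pose K := M ^+ 2; have K0 : 0 < K by rewrite exprn_gt0.
pose B := 1 - K^-1%:C *: A.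
have BB : is_adjoint B B := is_adjointD is_adjoint1 (is_adjointN (is_adjointZ _ AA)).
pose b2 := 1 - c ^+ 2 / K.
have cK : c ^+ 2 <= K by rewrite ler_sqr ?nnegrE ?(ltW c0) ?(ltW M0)// lerDr.
have b2_ge0 : 0 <= b2 by rewrite subr_ge0 ler_pdivrMr// mul1r.
have b2_lt1 : b2 < 1 by rewrite gtrBl divr_gt0// exprn_gt0.
pose b := Num.sqrt b2.
have b0 : 0 <= b by exact: sqrtr_ge0.
have b1 : b < 1 by rewrite -[ltRHS]sqrtr1 ltr_sqrt.
have Bb : op_bound B b.
  move=> x; rewrite -(ler_sqr (x := rnorm _)) ?nnegrE ?mulr_ge0 ?rnorm_ge0//.
  rewrite exprMn sqr_sqrtr//.
  have -> : B x = x + - (K^-1%:C *: A x) by [].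
  rewrite rnorm_sqrD rnormN rinnerNr rinnerZr rnormZ ger0_norm ?invr_ge0 ?(ltW K0)//.
  have -> : rinner x (A x) = rnorm (G x) ^+ 2 by rewrite rnorm_sqr GG.
  have Ax : rnorm (A x) ^+ 2 <= K * rnorm (G x) ^+ 2.
    rewrite -exprMn ler_sqr ?nnegrE ?mulr_ge0 ?rnorm_ge0 ?(ltW M0)//.
    exact: (is_adjoint_bound (ltW M0) GG GM).
  have Gx : c ^+ 2 * rnorm x ^+ 2 <= rnorm (G x) ^+ 2.
    by rewrite -exprMn ler_sqr ?nnegrE ?mulr_ge0 ?rnorm_ge0 ?(ltW c0).
  have K1 : 0 <= K^-1 by rewrite invr_ge0 ltW.
  have h1 := ler_wpM2l (mulr_ge0 K1 K1) Ax.
  have h2 := ler_wpM2l K1 Gx.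
  rewrite (mulrA _ K) divfK ?gt_eqF// in h1.
  rewrite /b2; lra.
have [Y [Yb YE YY YC]] := sqrt_of_one_sub b0 b1 Bb BB.
pose Q := M%:C *: (1 - Y); exists Q; split.
- exact: is_adjointZ (is_adjointD is_adjoint1 (is_adjointN YY)).
- rewrite /Q bop_scaleAl bop_scaleAr scalerA YE /B subKr scalerA -!rmorphM.
  by rewrite -/A -expr2 mulfV ?gt_eqF// scale1r.
- exists (M * (1 - b)); first by rewrite mulr_gt0 ?subr_gt0.
  move=> x; rewrite /Q bop_scaleE rinnerZl -mulrA ler_pM2l//.
  have := rinner_le (Y x) x; have := ler_wpM2r (rnorm_ge0 x) (Yb x).
  rewrite bop_addE bop_oppE bop_oneE !rinnerE -rnorm_sqr; lra.
- have [V [V1 V2]] := neumann b0 b1 Yb; exists (M^-1%:C *: V).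
  split; rewrite bop_scaleAl bop_scaleAr scalerA -rmorphM ?V1 ?V2.
    by rewrite mulfV ?gt_eqF// scale1r.
  by rewrite mulVf ?gt_eqF// scale1r.
- move=> C CA; have CB : C * B = B * C.
    by rewrite mulrBr mulrBl bop_scaleAr bop_scaleAl CA mulr1 mul1r.
  by rewrite /Q bop_scaleAr bop_scaleAl mulrBr mulrBl YC// mulr1 mul1r.
Qed.

(** Let [y = (S - Q) x]. As [S] and [Q] commute, [(S + Q) y = 0], so
    [0 = <S y, y> + <Q y, y>] and the coercivity of [Q] gives [y = 0]. *)
Lemma positive_sqrt_unique Q S d : 0 < d ->
  (forall x, d * rnorm x ^+ 2 <= rinner (Q x) x) -> bop_positive S ->
  S * Q = Q * S -> S * S = Q * Q -> S = Q.
Proof.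
move=> d0 Qd S0 SQ SS; apply: bop_ext => x.
apply/eqP; rewrite -subr_eq0; apply/eqP/rnorm0_eq0.
set y := S x - Q x.
have QSy : S y + Q y = 0.
  have : (S + Q) * (S - Q) = 0.
    by rewrite mulrDl !mulrBr SS SQ addrA subrK subrr.
  by move=> /(congr1 (fun A : bop H => A x)).
have := Qd y; have := bop_positive_ge0 y S0.
have : rinner (S y) y + rinner (Q y) y = 0 by rewrite -rinnerDl QSy rinner0l.
have := rnorm_ge0 y => y0 h1 h2 h3.
have : d * rnorm y ^+ 2 <= 0 by lra.
by rewrite pmulr_rle0// => h; apply/eqP; rewrite -sqrf_eq0 eq_le h sqr_ge0.
Qed.

(** The last clause is how absolute values are computed: by exhibiting a
    positive root. *)
Lemma bop_absP G c : bounded_below G c ->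
  [/\ is_adjoint (bop_abs G) (bop_abs G), bop_positive (bop_abs G),
      bop_abs G * bop_abs G = adjoint G * G, exists V, is_inverse (bop_abs G) V &
      forall S, bop_positive S -> S * S = adjoint G * G -> bop_abs G = S].
Proof.
move=> /sqrt_exists[Q [QQ QE [d d0 Qd] QV QC]].
have Q0 : bop_positive Q.
  apply: bop_positiveP => // x.
  by rewrite (le_trans _ (Qd x))// mulr_ge0 ?sqr_ge0 ?ltW.
have uniqQ S : bop_positive S -> S * S = adjoint G * G -> S = Q.
  move=> S0 SE; apply: (positive_sqrt_unique d0) => //; last by rewrite SE.
  by apply: QC; rewrite -SE mulrA.
have -> : bop_abs G = Q.
  have [|S0 SE] := @xgetPex _ 0
      [set S : bop H | bop_positive S /\ S * S = adjoint G * G].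
    by exists Q.
  exact: uniqQ.
by split=> // S S0 SE; rewrite (uniqQ S).
Qed.

Lemma bop_invE A V : is_inverse A V -> bop_inv A = V.
Proof.
move=> [AV VA].
have [|AW WA] := @xgetPex _ 0 [set B : bop H | A * B = 1 /\ B * A = 1].
  by exists V.
by rewrite -[LHS]mul1r -VA -mulrA AW mulr1.
Qed.

Lemma is_adjoint_inverse A V : is_adjoint A A -> is_inverse A V -> is_adjoint V V.
Proof.
move=> AA [AV _] x y.
have AVE z : A (V z) = z by rewrite -bop_mulE AV.
by rewrite -{1}(AVE y) -AA AVE.
Qed.

(** * The phase of an involution *)

(** With [Q = |S|], [V = Q^-1] and [T] the real part of [S], the square of
    [(Q + V) / 2] is [T * T], so [|T| = (Q + V) / 2] and [T = S * V * |T|]. *)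
Lemma involution_phase S : S * S = 1 ->
  S * bop_inv (bop_abs S) =
  (2^-1)%:C *: (S + adjoint S) * bop_inv (bop_abs ((2^-1)%:C *: (S + adjoint S))).
Proof.
move=> SS; set h : R[i] := (2^-1)%:C; set S' := adjoint S; set T := h *: (S + S').
have SA : is_adjoint S S' by exact: adjointP.
have SS' : S' * S' = 1.
  apply: (is_adjoint_uniq (A := 1)); last exact: is_adjoint1.
  by rewrite -SS; exact: is_adjointM.
have TA : is_adjoint T T.
  apply: is_adjointZ; rewrite [X in is_adjoint _ X]addrC.
  by apply: is_adjointD => //; exact: is_adjointC.
(* [S] is its own inverse and is bounded. *)
have S_below : exists c, bounded_below S c.
  have [M M0 SM] := op_boundP S; have M1 : 0 < M + 1 by rewrite ltr_wpDl.
  exists (M + 1)^-1; split; first by rewrite invr_gt0.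
  move=> x; rewrite ler_pdivrMl// -[X in rnorm X](_ : S (S x) = x).
    by rewrite (le_trans (SM _))// ler_wpM2r ?rnorm_ge0// lerDl.
  by rewrite -bop_mulE SS.
(* [|2 T x|^2 = |S x|^2 + |S' x|^2 + 2 |x|^2] since [<S x, S' x> = <S S x, x>]. *)
have T_below : bounded_below T 2^-1.
  split=> // x; rewrite -ler_sqr ?nnegrE ?mulr_ge0 ?rnorm_ge0//.
  rewrite bop_scaleE bop_addE rnormZ ger0_norm// !exprMn.
  rewrite ler_wpM2l ?sqr_ge0// rnorm_sqrD -SA -bop_mulE SS -rnorm_sqr.
  have := sqr_ge0 (rnorm x); have := sqr_ge0 (rnorm (S x)).
  by have := sqr_ge0 (rnorm (S' x)); lra.
have [c Sc] := S_below.
have [QA Q0 QQ [V QV] _] := bop_absP Sc.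
have [_ _ _ [W TW] uniqT] := bop_absP T_below.
rewrite (bop_invE QV) (bop_invE TW).
move: QA Q0 QQ QV; set Q := bop_abs S => QA Q0 QQ QV.
have [QV1 VQ1] := QV.
(* [S' * S = Q * Q] has inverse [S * S'] since [S] and [S'] are involutions. *)
have VV : V * V = S * S'.
  have VVQQ : V * V * (Q * Q) = 1 by rewrite mulrA -(mulrA V) VQ1 mulr1.
  rewrite -[LHS]mulr1 -[X in _ * X = _](_ : Q * Q * (S * S') = 1).
    by rewrite mulrA VVQQ mul1r.
  by rewrite QQ mulrA -(mulrA S') SS mulr1.
have absT : bop_abs T = h *: (Q + V).
  apply: uniqT.
    apply: bop_positiveP => [|x].
      exact/is_adjointZ/is_adjointD/(is_adjoint_inverse QA QV).
    rewrite bop_scaleE bop_addE rinnerZl mulr_ge0// rinnerDl addr_ge0//.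
      exact: bop_positive_ge0.
    have {2}-> : x = Q (V x) by rewrite -bop_mulE QV1.
    by rewrite -QA; exact: bop_positive_ge0.
  rewrite (adjointE TA) /T !bop_scaleAl !bop_scaleAr; congr (_ *: (_ *: _)).
  by rewrite !mulrDl !mulrDr QQ QV1 VQ1 VV SS SS' addrC.
have -> : T * W = S * V * bop_abs T * W.
  congr (_ * _); rewrite absT bop_scaleAr; congr (_ *: _).
  by rewrite mulrDr -!mulrA VQ1 VV mulr1 mulrA SS mul1r.
by have [TW1 _] := TW; rewrite -mulrA TW1 mulr1.
Qed.

End HilbertSpaceOperators.

Theorem theorem2p3 (R : realType) (H : hilbertType R) (sepH : separable_space H)
    (P : bop H) (idemP : P * P = P) :
  (2 *: P - 1) * bop_inv (bop_abs (2 *: P - 1)) =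
  (P + adjoint P - 1) * bop_inv (bop_abs (P + adjoint P - 1)).
Proof.
have two_P : 2 *: P = P + P by rewrite scaler_nat mulr2n.
set S := 2 *: P - 1.
have SS : S * S = 1.
  rewrite /S two_P mulrBl mul1r mulrBr mulr1 mulrDl !mulrDr idemP.
  by rewrite addrK subKr.
rewrite (involution_phase SS).
have PA := @adjointP _ _ P.
have -> : adjoint S = adjoint P + adjoint P - 1.
  apply: adjointE; rewrite /S two_P.
  exact: is_adjointD (is_adjointD PA PA) (is_adjointN (@is_adjoint1 R H)).
suff -> : (2^-1)%:C *: (S + (adjoint P + adjoint P - 1)) = P + adjoint P - 1 by [].
rewrite -[RHS](half_double (P + adjoint P - 1)) /S two_P; congr (_ *: _).
by rewrite addrACA [RHS]addrACA (addrACA P).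
Qed.
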